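(* For $v = a + b\omega_1 + c\omega_3 + d\omega_1\omega_3 \in L_{Moser}$ with $a,b,c,d\in\mathbb{Z}$, let $l_1(v), l_2(v) \in \{0,1\}$ be the residues $l_1 \equiv a+b+d \pmod 2$ and $l_2 \equiv a+c+d \pmod 2$. Then the coloring $\gamma_1$ of $L_{Moser}$ given by the color map $\pi_{\gamma_1}: L_{Moser}\to\{1,2,3,4\}$, \[ \pi_{\gamma_1}(v) = 1 + l_1(v) + 2\,l_2(v), \] is a geometric 4-coloring of $L_{Moser}$.
   Context: Let $\omega_1 = \frac12 + i\frac{\sqrt3}{2}$ and $\omega_3 = \frac56 + i\frac{\sqrt{11}}{6}$ in $\mathbb{C}\cong\mathbb{R}^2$. The Moser lattice is the additive group $L_{Moser} = \{a + b\omega_1 + c\omega_3 + d\omega_1\omega_3 : a,b,c,d\in\mathbb{Z}\}$; the integer coordinates $(a,b,c,d)$ of a point are unique. For points $x,y$ of the plane, $d(x,y)=|x-y|$ is the Euclidean distance. For an additive subgroup $L$ of the plane, an (integral, i.e. non-fractional) geometric $k$-coloring of $L$ is a map $\pi: L\to\{1,\dots,k\}$ such that (i) it is proper for unit distance: $d(x,y)=1 \implies \pi(x)\neq\pi(y)$; and (ii) it is geometric: for all $x,y,z,w\in L$ with $d(x,y)=d(z,w)$, one has $\pi(x)=\pi(y) \iff \pi(z)=\pi(w)$. *)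

(* Defs.v *)
From HB Require Import structures.
From mathcomp Require Import all_boot all_order all_algebra.
From mathcomp Require Import complex.
From mathcomp Require Import boolp classical_sets reals.

Set Implicit Arguments.
Unset Strict Implicit.
Unset Printing Implicit Defensive.

Import Order.TTheory GRing.Theory Num.Theory.
Local Open Scope classical_set_scope.
Local Open Scope complex_scope.
Local Open Scope ring_scope.

Definition omega1 (R : realType) : R[i] := (1 / 2) +i* (Num.sqrt 3 / 2).

Definition omega3 (R : realType) : R[i] := (5 / 6) +i* (Num.sqrt 11 / 6).

Definition moser_point (R : realType) (a b c d : int) : R[i] :=
  a%:~R + b%:~R * omega1 R + c%:~R * omega3 R + d%:~R * (omega1 R * omega3 R).

Definition moser_lattice (R : realType) : set R[i] :=
  [set v | exists q : int * int * int * int,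
     let: (a, b, c, d) := q in v = moser_point R a b c d].

Arguments moser_lattice R : clear implicits.

(* [`|x - y|] is the Euclidean distance, embedded as a real element of R[i]. *)
Definition geometric_coloring (R : realType) (L : set R[i]) (k : nat)
    (pi : L -> nat) : Prop :=
  [/\ forall x : L, (1 <= pi x <= k)%N,
      forall x y : L, `|val x - val y| = 1 -> pi x <> pi y
    & forall x y z w : L, `|val x - val y| = `|val z - val w| ->
        (pi x = pi y <-> pi z = pi w)].

Definition residue2 (m : int) : nat := `|(m %% 2)%Z|%N.

Definition gamma1_formula (a b c d : int) : nat :=
  (1 + residue2 (a + b + d) + 2 * residue2 (a + c + d))%N.

(* Integer coordinates are obtained by choice from membership in the lattice;
   independence of the choice is not built into the definition. *)
Definition gamma1 (R : realType) (v : moser_lattice R) : nat :=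
  let: (a, b, c, d) := projT1 (cid (set_valP v)) in gamma1_formula a b c d.

(* Main.v *)
Require Import Defs.
From HB Require Import structures.
From mathcomp Require Import all_boot all_order all_algebra.
From mathcomp Require Import complex.
From mathcomp Require Import boolp classical_sets reals.
From mathcomp Require Import zify ring lra.

Set Implicit Arguments.
Unset Strict Implicit.
Unset Printing Implicit Defensive.

Import Order.TTheory GRing.Theory Num.Theory.
Local Open Scope ring_scope.

(** For [v] with coordinates [(a, b, c, d)] one has [6 |v|^2 = P + Q sqrt 33]
    with integers [P], [Q]; since [sqrt 33] is irrational, [|v|] determines
    [P + Q].  Modulo 4, [P + Q] is twice the norm form
    [l1^2 + l1 l2 + l2^2], which is anisotropic over [F_2].  Hence [|v|]
    decides whether [l1 v = l2 v = 0], and [l1], [l2] being additive, this for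
    [v = x - y] says exactly that [x] and [y] have the same color.  Distance 1
    gives [P + Q = 6], not a multiple of 4; distance 0 gives [P + Q = 0], so
    the color does not depend on the chosen coordinates. *)

Definition normP (a b c d : int) : int :=
  6 * (a ^+ 2 + a * b + b ^+ 2 + c ^+ 2 + c * d + d ^+ 2)
  + 10 * (a * c + b * d) + 5 * (a * d + b * c).

Definition normQ (a b c d : int) : int := b * c - a * d.

Lemma moser_pointB (R : realType) (a b c d a' b' c' d' : int) :
  moser_point R a b c d - moser_point R a' b' c' d' =
  moser_point R (a - a') (b - b') (c - c') (d - d').
Proof. by rewrite /moser_point !rmorphB /=; ring. Qed.

Lemma moser_point_norm (R : realType) (a b c d : int) :
  6 * `|moser_point R a b c d| ^+ 2 =
  ((normP a b c d)%:~R + (normQ a b c d)%:~R * (Num.sqrt 3 * Num.sqrt 11))%:C%C.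
Proof.
have s3 : Num.sqrt 3 ^+ 2 = 3 :> R by rewrite sqr_sqrtr.
have s11 : Num.sqrt 11 ^+ 2 = 11 :> R by rewrite sqr_sqrtr.
have intC (m : int) : m%:~R = (m%:~R : R)%:C%C
  by rewrite -[RHS]/(real_complex R _) rmorph_int.
have natC (n : nat) : n%:R = (n%:R : R)%:C%C
  by rewrite -[RHS]/(real_complex R _) rmorph_nat.
rewrite sqr_normc /moser_point /omega1 /omega3 !intC natC /normP /normQ.
rewrite !(rmorphD, rmorphB, rmorphM, rmorphXn) /=.
(* With the roots abstracted, the imaginary part vanishes identically; the real part uses
   [s ^+ 2 = 3] and [t ^+ 2 = 11]. *)
move: (Num.sqrt 3) (Num.sqrt 11) s3 s11 => s t s3 s11.
apply/eqP; rewrite eq_complex /=; apply/andP; split; apply/eqP; last by field.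
by field: s3 s11.
Qed.

(** For nonzero [n], the exponent of 3 is even on the left and odd on the right. *)
Lemma sqr_eq_33sqr (m n : nat) : (m ^ 2 = 33 * n ^ 2)%N -> n = 0%N.
Proof.
case: n => // n mn; have := congr1 (odd \o logn 3) mn.
by rewrite /= lognM ?expn_gt0 // !lognX oddD !mul2n !odd_double.
Qed.

Lemma int_sqrt33_inj (F : realFieldType) (s : F) (p q p' q' : int) :
  s ^+ 2 = 33 -> p%:~R + q%:~R * s = p'%:~R + q'%:~R * s -> p = p' /\ q = q'.
Proof.
move=> s2 e; have e1 : (p - p')%:~R = (q' - q)%:~R * s.
  by rewrite !rmorphB /=; lra.
have e2 : (p - p') ^+ 2 = 33 * (q' - q) ^+ 2.
  apply: (@intr_inj F); rewrite rmorphXn /= e1 exprMn s2 rmorphM rmorphXn /=.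
  by rewrite mulrC.
have /sqr_eq_33sqr q0 : (`|(p - p')%R| ^ 2 = 33 * `|(q' - q)%R| ^ 2)%N.
  by rewrite -!abszX e2 abszM.
have q0' : q' - q = 0 by apply/eqP; rewrite -absz_eq0 q0.
move: e1; rewrite q0' mul0r => /eqP; rewrite intr_eq0 => /eqP p0.
by split; lia.
Qed.

Lemma moser_norm_inj (R : realType) (a b c d a' b' c' d' : int) :
  `|moser_point R a b c d| = `|moser_point R a' b' c' d'| ->
  normP a b c d = normP a' b' c' d' /\ normQ a b c d = normQ a' b' c' d'.
Proof.
move=> e; apply: (@int_sqrt33_inj R (Num.sqrt 3 * Num.sqrt 11)).
  by rewrite exprMn !sqr_sqrtr ?ler0n // -natrM.
apply: (@complexI R).
by rewrite -!moser_point_norm e.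
Qed.

Lemma dvdz4_normPQ (a b c d : int) :
  (4 %| normP a b c d + normQ a b c d)%Z =
  (2 %| a + b + d)%Z && (2 %| a + c + d)%Z.
Proof.
have -> : normP a b c d + normQ a b c d =
    2 * ((a + b + d) ^+ 2 + (a + b + d) * (a + c + d) + (a + c + d) ^+ 2)
    + 4 * (b ^+ 2 + c ^+ 2 + a * c + b * d - 2 * (a * d) + b * c).
  by rewrite /normP /normQ; ring.
move: (_ + _ - _ + _) (a + b + d) (a + c + d) => k u v.
have [m [r [-> r2]]] : exists m r : int, u = 2 * m + r /\ (r = 0 \/ r = 1).
  by exists (u %/ 2)%Z, (u %% 2)%Z; lia.
have [n [s [-> s2]]] : exists n s : int, v = 2 * n + s /\ (s = 0 \/ s = 1).
  by exists (v %/ 2)%Z, (v %% 2)%Z; lia.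
(* Collects a multiple of 4, so that only the residues [r] and [s] matter. *)
have -> : 2 * ((2 * m + r) ^+ 2 + (2 * m + r) * (2 * n + s) + (2 * n + s) ^+ 2)
    + 4 * k =
    4 * (2 * m ^+ 2 + 2 * m * r + 2 * m * n + m * s + n * r
         + 2 * n ^+ 2 + 2 * n * s + k) + 2 * (r ^+ 2 + r * s + s ^+ 2).
  by ring.
(* The remainder [2 * (r ^+ 2 + r * s + s ^+ 2)] is 0, 2, 2 or 6, divisible by 4 only for
   [r = s = 0]. *)
by move: (_ + k) => K; case: r2 => ->; case: s2 => ->; rewrite !expr2; lia.
Qed.

(** The two residues are the binary digits of the color minus 1, so equal colors mean that both
    linear forms are even on the difference. *)
Lemma gamma1_formula_eq (a b c d a' b' c' d' : int) :
  gamma1_formula a b c d = gamma1_formula a' b' c' d' <->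
  (4 %| normP (a - a') (b - b') (c - c') (d - d')
        + normQ (a - a') (b - b') (c - c') (d - d'))%Z.
Proof. by rewrite dvdz4_normPQ /gamma1_formula /residue2; split; lia. Qed.

(** Hides the choice behind existential witnesses. *)
Lemma gamma1_coordinates (R : realType) (v : moser_lattice R) :
  exists a b c d : int,
    val v = moser_point R a b c d /\ gamma1 v = gamma1_formula a b c d.
Proof.
rewrite /gamma1; case: cid => -[[[a b] c] d] /= e.
by exists a, b, c, d.
Qed.

Theorem theorem3p1 (R : realType) :
  (forall (v : moser_lattice R) (a b c d : int),
     val v = moser_point R a b c d ->
     gamma1 v = (1 + residue2 (a + b + d) + 2 * residue2 (a + c + d))%N)
  /\ geometric_coloring 4 (@gamma1 R).
Proof.
(* Writing 0 and 1 as lattice points lets [moser_norm_inj] handle the distances 0 and 1. *)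
have zeroE : 0 = moser_point R 0 0 0 0 by rewrite /moser_point; ring.
have oneE : 1 = moser_point R 1 0 0 0 by rewrite /moser_point; ring.
split=> [v a b c d ve|].
  rewrite -/(gamma1_formula a b c d).
  have [a' [b' [c' [d' [ve' ->]]]]] := gamma1_coordinates v.
  apply/gamma1_formula_eq.
  have e : moser_point R (a' - a) (b' - b) (c' - c) (d' - d)
      = moser_point R 0 0 0 0.
    by rewrite -moser_pointB -ve' ve subrr.
  have /moser_norm_inj[-> ->] // :
    `|moser_point R (a' - a) (b' - b) (c' - c) (d' - d)|
      = `|moser_point R 0 0 0 0| by rewrite e.
split=> [x|x y|x y z w].
- have [a [b [c [d [_ ->]]]]] := gamma1_coordinates x.
  by rewrite /gamma1_formula /residue2; lia.
- have [a [b [c [d [-> ->]]]]] := gamma1_coordinates x.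
  have [a' [b' [c' [d' [-> ->]]]]] := gamma1_coordinates y.
  rewrite moser_pointB -[RHS]normr1 [in `|1|]oneE => /moser_norm_inj[P6 Q0].
  by move=> /gamma1_formula_eq; rewrite P6 Q0.
- have [a [b [c [d [-> ->]]]]] := gamma1_coordinates x.
  have [a' [b' [c' [d' [-> ->]]]]] := gamma1_coordinates y.
  have [e [f [g [h [-> ->]]]]] := gamma1_coordinates z.
  have [e' [f' [g' [h' [-> ->]]]]] := gamma1_coordinates w.
  rewrite !moser_pointB => /moser_norm_inj[eP eQ].
  by rewrite !gamma1_formula_eq eP eQ.
Qed.
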